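(* There is a linear order $\prec$ on $\mathbb{N}$ such that $\mathrm{FO}(<,\prec)$ has the same expressive power as $\mathrm{FO}(\mathrm{Bit})$ on the class of all finite structures.
   Context: Built-in predicates: a $k$-ary numerical predicate $P\subseteq\mathbb{N}^k$ is interpreted on a finite structure with universe $[n]=\{0,\dots,n\}$ as $P^n=P\cap[n]^k$. For a list $\ell$ of such predicates, $\mathrm{FO}(\ell)$ is first-order logic over finite structures with universe $[n]$ (arbitrary $n$, arbitrary finite relational signature) that may additionally use symbols for the predicates in $\ell$, interpreted as $P^n$. Two such logics have the same expressive power if every formula of either is equivalent, on all finite structures, to a formula of the other. $<$ is the usual order on $\mathbb{N}$ and $\mathrm{Bit}=\{(a,i)\in\mathbb{N}^2 : 2\nmid\lfloor a/2^i\rfloor\}$. *)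

(* Defs.v *)
From mathcomp Require Import all_boot.
Set Implicit Arguments. Unset Strict Implicit. Unset Printing Implicit Defensive.

Record numpred := NumPred { np_ar : nat; np_rel : np_ar.-tuple nat -> Prop }.

Definition np_default : numpred := @NumPred 0 (fun _ => False).

Definition binpred (R : nat -> nat -> Prop) : numpred :=
  @NumPred 2 (fun t => R (nth 0 t 0) (nth 0 t 1)).

Definition lt_pred : numpred := binpred (fun a b => a < b).

Definition Bit_pred : numpred := binpred (fun a i => ~ (2 %| a %/ 2 ^ i)).

(* A relational signature: the list of arities of its relation symbols. *)
Definition signature := seq nat.

Inductive formula (sg : signature) (l : seq numpred) : Type :=
  | FEq : nat -> nat -> formula sg l
  | FRel : forall i : 'I_(size sg), (nth 0 sg i).-tuple nat -> formula sg l
  | FPred : forall j : 'I_(size l), (np_ar (nth np_default l j)).-tuple nat -> formula sg l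
  | FNot : formula sg l -> formula sg l
  | FAnd : formula sg l -> formula sg l -> formula sg l
  | FEx : nat -> formula sg l -> formula sg l.

(* Interpretation of the relation symbols of sg (on universe [n], only
   tuples over [n] are ever consulted). *)
Definition structure (sg : signature) :=
  forall i : 'I_(size sg), (nth 0 sg i).-tuple nat -> Prop.

Definition upd (a : nat -> nat) (x v : nat) : nat -> nat :=
  fun y => if y == x then v else a y.

(* Satisfaction in the structure with universe [n] = {0..n}; built-in
   predicate P is interpreted as P^n = P ∩ [n]^k. *)
Fixpoint sat (sg : signature) (l : seq numpred) (n : nat) (S : structure sg)
    (a : nat -> nat) (f : formula sg l) : Prop :=
  match f with
  | FEq x y => a x = a y
  | FRel i xs => S i (map_tuple a xs)
  | FPred j xs => all (fun v => v <= n) (map_tuple a xs) /\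
                  np_rel (map_tuple a xs)
  | FNot g => ~ sat n S a g
  | FAnd g h => sat n S a g /\ sat n S a h
  | FEx x g => exists v, v <= n /\ sat n S (upd a x v) g
  end.

Definition equivalent (sg : signature) (l1 l2 : seq numpred)
    (f : formula sg l1) (g : formula sg l2) : Prop :=
  forall (n : nat) (S : structure sg) (a : nat -> nat),
    (forall x, a x <= n) -> (sat n S a f <-> sat n S a g).

Definition same_expressive_power (l1 l2 : seq numpred) : Prop :=
  forall sg : signature,
    (forall f : formula sg l1, exists g : formula sg l2, equivalent f g) /\
    (forall g : formula sg l2, exists f : formula sg l1, equivalent f g).

Definition strict_linear_order (R : nat -> nat -> Prop) : Prop :=
  (forall x, ~ R x x) /\
  (forall x y z, R x y -> R y z -> R x z) /\
  (forall x y, x <> y -> R x y \/ R y x).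

(* Main.v *)
Require Import Defs.
From mathcomp Require Import all_boot.
From mathcomp Require Import zify.
From Stdlib Require Import Classical.

(** The order [prec] compares numbers at their lowest differing binary digit,
    except that the odd numbers [2 ^ i + i] ([i] odd) are moved in front.

    Given [<] and [prec], the moved numbers are those preceding 0, and parity is
    read off from comparing consecutive numbers. Among even numbers, powers of two
    are the minima from left to right, and [x %% 2 ^ i.+1] is the last
    number below [2 ^ i.+1] that is not after [x]; this gives the digit of [x] at
    the power [2 ^ i]. The moved numbers then provide the map from [i] to [2 ^ i].

    Conversely [prec] is clearly definable from [Bit] once [<] is. For the latter,
    numbers compare as their top differing digit positions do; this is iterated
    three times, after which the positions are so small that their order, viewed
    as the chain of its initial segments, is coded by a single number. *)

Set Implicit Arguments. Unset Strict Implicit. Unset Printing Implicit Defensive.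

(** * Binary digits *)

Definition bit (x i : nat) : bool := odd (x %/ 2 ^ i).

Lemma bit0 x : bit x 0 = odd x.
Proof. by rewrite /bit expn0 divn1. Qed.

Lemma bit_zero i : bit 0 i = false.
Proof. by rewrite /bit div0n. Qed.

Lemma bitS x i : bit x i.+1 = bit x./2 i.
Proof. by rewrite /bit expnS divnMA divn2. Qed.

Lemma bit_ge x i : bit x i -> 2 ^ i <= x.
Proof. by case: (leqP (2 ^ i) x) => // lt_x; rewrite /bit divn_small. Qed.

Lemma bit_index_lt x i : bit x i -> i < x.
Proof. by move/bit_ge; apply: leq_trans; apply: ltn_expl. Qed.

Lemma bit_Bit_pred x i : bit x i <-> ~ (2 %| x %/ 2 ^ i).
Proof. by rewrite dvdn2 /bit; case: odd; split. Qed.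

(** Splitting off the lowest digit turns reduction modulo [2 ^ k.+1] into reduction of the half
    modulo [2 ^ k], so induction on [k] applies. *)
Lemma bit_mod x k i : bit (x %% 2 ^ k) i = (i < k) && bit x i.
Proof.
elim: k i x => [|k IHk] i x; first by rewrite expn0 modn1 /bit div0n.
have Ex : x %% 2 ^ k.+1 = odd x + (x./2 %% 2 ^ k).*2.
  rewrite expnS -{1}(odd_double_half x) -!muln2 (mulnC 2) -modnDmr -muln_modl.
  rewrite modn_small //.
  have : x./2 %% 2 ^ k < 2 ^ k by rewrite ltn_mod expn_gt0.
  case: (odd x); lia.
case: i => [|i]; first by rewrite !bit0 Ex oddD odd_double addbF oddb.
by rewrite !bitS Ex half_bit_double IHk ltnS.
Qed.

Lemma bit_top_add k y i : y < 2 ^ k -> bit (2 ^ k + y) i = (i == k) || bit y i.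
Proof.
elim: k i y => [|k IHk] i y lt_y.
  have -> : y = 0 by rewrite expn0 in lt_y; lia.
  by case: i => [|i]; rewrite ?bitS // /bit div0n.
rewrite expnS in lt_y *.
case: i => [|i]; first by rewrite !bit0; lia.
have Eh : (2 * 2 ^ k + y)./2 = 2 ^ k + y./2 by lia.
by rewrite !bitS Eh IHk //; lia.
Qed.

Lemma bit_ones a i : bit (2 ^ a).-1 i = (i < a).
Proof.
elim: a => [|a IHa]; first by rewrite /bit div0n.
have a_gt0 : 0 < 2 ^ a by rewrite expn_gt0.
have -> : (2 ^ a.+1).-1 = 2 ^ a + (2 ^ a).-1 by rewrite expnS; lia.
by rewrite bit_top_add ?IHa; lia.
Qed.

(** Numbers below [2 ^ k] thus code all subsets of [{0, ..., k - 1}]; the code is built by deciding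
    one new top digit at a time. *)
Lemma bit_comprehension (f : pred nat) k :
  exists2 s, s < 2 ^ k & forall i, bit s i = (i < k) && f i.
Proof.
elim: k => [|k [s lt_s Hs]].
  by exists 0 => // i; rewrite /bit div0n.
case fk : (f k).
  exists (2 ^ k + s) => [|i]; first by rewrite expnS; lia.
  by rewrite bit_top_add // Hs ltnS [i <= k]leq_eqVlt; case: eqP => // ->; rewrite fk.
exists s => [|i]; first by rewrite expnS; lia.
by rewrite Hs ltnS [i <= k]leq_eqVlt; case: eqP => // ->; rewrite fk ltnn.
Qed.

(** Induction by halving: if the halves differ, their top difference is shifted up by one; otherwise
    the parities decide. *)
Lemma ltn_top_bit x y : x < y ->
  exists k, [/\ bit y k, ~~ bit x k & forall j, k < j -> bit x j = bit y j].
Proof.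
have [m] := ubnP y; elim: m x y => // m IHm x y lt_ym lt_xy.
have [lt_h | le_h] := ltnP x./2 y./2.
  have [|k [yk xk H]] := IHm _ _ _ lt_h; first by lia.
  by exists k.+1; rewrite !bitS; split=> // -[|j] // /H; rewrite !bitS.
have Eh : x./2 = y./2 by lia.
have [oy ox] : odd y /\ ~~ odd x by lia.
by exists 0; rewrite !bit0; split=> // -[|j] // _; rewrite !bitS Eh.
Qed.

Lemma bit_inj x y : (forall i, bit x i = bit y i) -> x = y.
Proof.
move=> H; case: (ltngtP x y) => // /ltn_top_bit[k []].
  by rewrite H => ->.
by rewrite -H => ->.
Qed.

Lemma top_bit_ltn x y k :
  bit y k -> ~~ bit x k -> (forall j, bit x j != bit y j -> j <= k) -> x < y.
Proof.
move=> yk xk H; case: (ltngtP x y) => // [/ltn_top_bit[j [xj yj Hj]] | Exy].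
  have : j <= k by apply: H; rewrite xj (negPf yj).
  rewrite leq_eqVlt => /predU1P[Ej | /Hj]; first by rewrite Ej yk in yj.
  by rewrite yk (negPf xk).
by rewrite Exy yk in xk.
Qed.

Lemma neq_low_bit x y : x <> y ->
  exists2 k, bit x k != bit y k & forall j, j < k -> bit x j = bit y j.
Proof.
move=> ne_xy; have ex_k : exists k, bit x k != bit y k.
  case: (ltngtP x y) ne_xy => // /ltn_top_bit[k [b1 b2 _]] _; exists k.
    by rewrite b1 (negPf b2).
  by rewrite b1 (negPf b2).
case: (ex_minnP ex_k) => k Hk mink; exists k => // j lt_jk.
by apply/eqP; apply: contraLR lt_jk => /mink; rewrite -leqNgt.
Qed.

(** * Definability *)

(* [Q n e] is a property of an assignment [e] over [[n]]. Quantifying over all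
   renamings [rho] makes room for bound variables, and locality (dependence on the
   first [N] variables only) guarantees that a fresh one exists. *)
Definition definable (sg : signature) (l : seq numpred)
    (Q : nat -> (nat -> nat) -> Prop) : Prop :=
  exists N,
    (forall n e e', (forall i, e i <= n) -> (forall i, e' i <= n) ->
       (forall i, i < N -> e i = e' i) -> Q n e -> Q n e') /\
    forall rho : nat -> nat, exists g : formula sg l,
      forall n (S : structure sg) a, (forall x, a x <= n) ->
        (sat n S a g <-> Q n (fun i => a (rho i))).

Lemma definable_iff sg l (P Q : nat -> (nat -> nat) -> Prop) :
  (forall n e, (forall i, e i <= n) -> (P n e <-> Q n e)) ->
  definable sg l P -> definable sg l Q.
Proof.
move=> PQ [N [loc fm]]; exists N; split=> [n e e' He He' Hee|rho].
  by move/(PQ _ _ He)/(loc _ _ _ He He' Hee)/(PQ _ _ He').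
have [g Hg] := fm rho; exists g => n S a Ha.
by apply: (iff_trans (Hg _ _ _ Ha)); apply: PQ.
Qed.

Lemma definable_eq sg l i j : definable sg l (fun n e => e i = e j).
Proof.
exists (maxn i j).+1; split=> [n e e' _ _ H|rho].
  by rewrite !H // ltnS ?leq_maxl ?leq_maxr.
by exists (FEq sg l (rho i) (rho j)).
Qed.

Lemma definable_not sg l P :
  definable sg l P -> definable sg l (fun n e => ~ P n e).
Proof.
move=> [N [loc fm]]; exists N; split=> [n e e' He He' H nP P'|rho].
  by apply: nP; apply: loc P' => // i /H.
have [g Hg] := fm rho; exists (FNot g) => n S a Ha /=.
by have := Hg n S a Ha; tauto.
Qed.

Lemma definable_and sg l P Q : definable sg l P -> definable sg l Q ->
  definable sg l (fun n e => P n e /\ Q n e).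
Proof.
move=> [N [loc fm]] [N' [loc' fm']]; exists (maxn N N'); split=> [n e e' He He' H|rho].
  case=> /(loc _ _ _ He He') H1 /(loc' _ _ _ He He') H2.
  by split; [apply: H1 | apply: H2] => i Hi; apply: H; rewrite leq_max Hi ?orbT.
have [[g Hg] [g' Hg']] := (fm rho, fm' rho); exists (FAnd g g') => n S a Ha /=.
have := Hg n S a Ha; have := Hg' n S a Ha; tauto.
Qed.

Definition scons (v : nat) (e : nat -> nat) (i : nat) : nat :=
  if i is j.+1 then e j else v.

(** Index 0 carries the bound variable and the other indices shift by one, as with de Bruijn
    indices; [rho] is extended by a variable [w] for index 0. *)
Lemma definable_ex sg l (P : nat -> (nat -> nat) -> nat -> Prop) :
  definable sg l (fun n e => P n (fun i => e i.+1) (e 0)) ->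
  definable sg l (fun n e => exists v, v <= n /\ P n e v).
Proof.
move=> [N [loc fm]].
have bnd v n e : v <= n -> (forall i, e i <= n) -> forall i, scons v e i <= n.
  by move=> Hv He [|i] /=.
exists N; split=> [n e e' He He' H [v [Hv Pv]]|rho].
  exists v; split=> //.
  have Hs i : i < N -> scons v e i = scons v e' i.
    by case: i => //= i Hi; apply: H; apply: ltnW.
  exact: (loc n (scons v e) (scons v e') (bnd _ _ _ Hv He) (bnd _ _ _ Hv He') Hs Pv).
(* [w] need only differ from [rho i] for [i < N]: updating it may change later values, but locality
   makes these irrelevant. *)
pose w := (\max_(i < N) rho i).+1.
have [g Hg] := fm (scons w rho); exists (FEx w g) => n S a Ha /=.
have Hu v : v <= n -> forall x, upd a w v x <= n.
  by move=> Hv x; rewrite /upd; case: ifP.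
have agree v i : i < N -> upd a w v (scons w rho i) = scons v (fun j => a (rho j)) i.
  case: i => [|i] Hi; rewrite /upd /=; first by rewrite eqxx.
  suff : rho i < w by rewrite ltn_neqAle => /andP[/negPf->].
  by rewrite ltnS; apply: (leq_bigmax (Ordinal (ltnW Hi))).
have Hb v (Hv : v <= n) := bnd v n (fun j => a (rho j)) Hv (fun j => Ha (rho j)).
split=> -[v [Hv Hs]]; exists v; split=> //.
  move/(Hg _ _ _ (Hu v Hv)): Hs => Hs.
  exact: (loc n _ _ (fun i => Hu v Hv _) (Hb v Hv) (agree v) Hs).
apply/(Hg _ _ _ (Hu v Hv)).
exact: (loc n (scons v (fun j => a (rho j))) _ (Hb v Hv) (fun i => Hu v Hv _)
          (fun i Hi => esym (agree v i Hi)) Hs).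
Qed.

Lemma definable_imp sg l P Q : definable sg l P -> definable sg l Q ->
  definable sg l (fun n e => P n e -> Q n e).
Proof.
move=> dP dQ; apply: definable_iff (definable_not (definable_and dP (definable_not dQ))).
by move=> n e _; have := classic (Q n e); tauto.
Qed.

Lemma definable_or sg l P Q : definable sg l P -> definable sg l Q ->
  definable sg l (fun n e => P n e \/ Q n e).
Proof.
move=> dP dQ; apply: definable_iff (definable_imp (definable_not dP) dQ).
by move=> n e _; have := classic (P n e); tauto.
Qed.

Lemma definable_equiv sg l P Q : definable sg l P -> definable sg l Q ->
  definable sg l (fun n e => P n e <-> Q n e).
Proof. by move=> dP dQ; apply: definable_and; apply: definable_imp. Qed.

Lemma definable_all sg l (P : nat -> (nat -> nat) -> nat -> Prop) :
  definable sg l (fun n e => P n (fun i => e i.+1) (e 0)) ->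
  definable sg l (fun n e => forall v, v <= n -> P n e v).
Proof.
move=> dP.
have := definable_not (definable_ex (P := fun n e v => ~ P n e v) (definable_not dP)).
apply: definable_iff => n e _; split=> [H v Hv|H [v [Hv]]]; last by apply; apply: H.
by apply: NNPP => nP; apply: H; exists v.
Qed.

Ltac definability :=
  repeat (cbv beta; first
    [ solve [auto with definable]
    | apply: definable_ex | apply: definable_all | apply: definable_equiv
    | apply: definable_and | apply: definable_or | apply: definable_not
    | apply: definable_imp | apply: definable_eq ]).

Lemma definable_binpred sg l (j : 'I_(size l)) R :
  nth np_default l j = binpred R ->
  forall x y, definable sg l (fun n e => R (e x) (e y)).
Proof.
move=> Ej x y; exists (maxn x y).+1; split=> [n e e' _ _ H|rho].
  by rewrite !H // ltnS ?leq_maxl ?leq_maxr.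
(* The predicate is abstracted to [p], since the type of the tuple depends on it and the equation
   can then be eliminated. *)
have atom p : nth np_default l j = p -> forall t : (np_ar p).-tuple nat,
    exists g : formula sg l, forall n (S : structure sg) a,
      sat n S a g <-> all (fun v => v <= n) (map_tuple a t) /\ np_rel (map_tuple a t).
  by move=> <- t; exists (FPred sg t).
have [g Hg] := atom _ Ej [tuple rho x; rho y]; exists g => n S a Ha.
by apply: (iff_trans (Hg n S a)); rewrite /= !Ha; split=> // -[].
Qed.

(** Induction on formulas; only the atoms for built-in predicates need replacing. *)
Lemma translate sg l1 l2 :
  (forall j : 'I_(size l1), exists2 R, nth np_default l1 j = binpred R &
     forall x y, definable sg l2 (fun n e => R (e x) (e y))) ->
  forall f : formula sg l1, exists g : formula sg l2, equivalent f g.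
Proof.
move=> H; elim=> [x y|i xs|j xs|f [g Hg]|f [g Hg] f' [g' Hg']|x f [g Hg]].
- by exists (FEq sg l2 x y).
- by exists (FRel l2 xs).
- have [R Ej dR] := H j.
  (* Unfolding satisfaction removes [FPred] from the goal, so that [Ej] can be rewritten in the type
     of [xs]. *)
  suff : exists g : formula sg l2, forall n (S : structure sg) a, (forall x, a x <= n) ->
      (all (fun v => v <= n) (map_tuple a xs) /\ np_rel (map_tuple a xs) <-> sat n S a g).
    by [].
  move: xs; rewrite Ej => -[[|x [|y []]] // sz].
  (* The renaming sends 0 to [x] and 1 to [y]. *)
  have [N [_ /(_ (nth 0 [:: x; y]))[g Hg]]] := dR 0 1; exists g => n S a Ha.
  apply: iff_trans (iff_sym (Hg n S a Ha)).
  by rewrite /= !Ha; split=> // -[].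
- by exists (FNot g) => n S a Ha /=; have := Hg n S a Ha; tauto.
- by exists (FAnd g g') => n S a Ha /=; have := Hg n S a Ha; have := Hg' n S a Ha; tauto.
exists (FEx x g) => n S a Ha /=.
have Hu v : v <= n -> forall y, upd a x v y <= n.
  by move=> Hv y; rewrite /upd; case: ifP.
by split=> -[v [Hv Hs]]; exists v; split=> //; apply/(Hg n S _ (Hu v Hv)).
Qed.

(** * The order is definable from [Bit] *)

Lemma definable_bit sg x y :
  definable sg [:: Bit_pred] (fun n e => bit (e x) (e y)).
Proof.
have := @definable_binpred sg [:: Bit_pred] ord0 _ erefl x y.
by apply: definable_iff => n e _; apply: iff_sym; apply: bit_Bit_pred.
Qed.
#[local] Hint Resolve definable_bit : definable.

(* [s] codes a set of sets [2 ^ a - 1 = {0, ..., a - 1}]; the clause says that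
   the order read off from this family of sets is the one obtained by comparing
   top differing bits, these bits being compared by the same family. *)
Definition segment_code (n s : nat) : Prop :=
  forall u, u <= n -> forall w, w <= n -> forall j, j <= n -> forall i, i <= n ->
  bit s u -> bit s w -> bit u j -> ~ bit u i -> bit w i ->
  exists k, k <= n /\ (bit i k /\ ~ bit j k /\
    (exists w', w' <= n /\ (bit s w' /\ bit w' k)) /\
    forall m, m <= n -> ~ (bit i m <-> bit j m) -> m <> k ->
      exists v, v <= n /\ (bit s v /\ bit v m /\ ~ bit v k)).

Definition seg_lt (n i j : nat) : Prop :=
  exists s, s <= n /\ (segment_code n s /\
    exists u, u <= n /\ (bit s u /\ bit u i /\ ~ bit u j /\
      exists w, w <= n /\ (bit s w /\ bit w j))).

(** Comparison at the top differing digit, with [R] as the order of positions; each use reduces the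
    order to logarithmically smaller numbers. *)
Definition bitwise_lt (R : nat -> nat -> nat -> Prop) (n x y : nat) : Prop :=
  exists k, k <= n /\ (bit y k /\ ~ bit x k /\
    forall m, m <= n -> ~ (bit x m <-> bit y m) -> m <> k -> R n m k).

Lemma definable_seg_lt sg x y :
  definable sg [:: Bit_pred] (fun n e => seg_lt n (e x) (e y)).
Proof. rewrite /seg_lt /segment_code; definability. Qed.

Lemma definable_bitwise_lt sg l R :
  (forall x y, definable sg l (fun n e => bit (e x) (e y))) ->
  (forall x y, definable sg l (fun n e => R n (e x) (e y))) ->
  forall x y, definable sg l (fun n e => bitwise_lt R n (e x) (e y)).
Proof. move=> db dR x y; rewrite /bitwise_lt; definability. Qed.

Lemma bit_neqP (x y m : nat) : ~ (bit x m <-> bit y m) <-> bit x m != bit y m.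
Proof. by case: (bit x m) (bit y m) => -[]; intuition. Qed.

(** The members of the family need not be initial segments. Induction on [j]: if [i < j], their top
    differing position [m'] is below [j], so the code and the induction hypothesis put it below [k].
    Then [i] and [j] agree at [k], contrary to the choice of [k]. *)
Lemma segment_code_ltn n s u w i j : s <= n -> segment_code n s ->
  bit s u -> bit s w -> bit u j -> ~ bit u i -> bit w i -> j < i.
Proof.
move=> le_sn code.
have [m] := ubnP j; elim: m u w i j => // m IHm u w i j le_jm su sw uj ui wi.
have le_n v : v < s -> v <= n by move=> lt_v; lia.
have [lt_us lt_ws] := (bit_index_lt su, bit_index_lt sw).
have [lt_ju lt_iw] := (bit_index_lt uj, bit_index_lt wi).
have [] // := code u _ w _ j _ i _ su sw uj ui wi; try lia.
move=> k [_ [ik [jk [[w' [_ [sw' w'k]]] Hk]]]].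
case: (ltngtP j i) => // [lt_ij|Eij]; last by rewrite Eij in uj.
have [m' [jm' im' Hm']] := ltn_top_bit lt_ij.
have lt_m'j := bit_index_lt jm'.
have ne_m'k : m' <> k by move=> E; rewrite E ik in im'.
have le_m'n : m' <= n := ltnW (ltn_trans lt_m'j (ltn_trans lt_ju (leq_trans lt_us le_sn))).
have [||v [_ [sv [vm' vk]]]] := Hk m' le_m'n => //.
  by apply/bit_neqP; rewrite jm' (negPf im').
have lt_m'k : m' < k := IHm v w' k m' (leq_trans lt_m'j (ltnSE le_jm)) sv sw' vm' vk w'k.
by case: jk; rewrite -Hm'.
Qed.

Lemma seg_lt_ltn n i j : seg_lt n i j -> i < j.
Proof.
move=> [s [le_s [code [u [_ [su [ui [uj [w [_ [sw wj]]]]]]]]]]].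
exact: segment_code_ltn code su sw ui uj wj.
Qed.

(** The segments [{0, ..., a - 1}] with [a <= j.+1] have codes below [2 ^ j.+1], so the whole family
    has a code below [2 ^ 2 ^ j.+1]. *)
Lemma ltn_seg_lt n i j : i < j -> 2 ^ 2 ^ j.+1 <= n -> seg_lt n i j.
Proof.
move=> lt_ij le_n; set A := j.+1 in le_n.
pose f u := [exists a : 'I_A.+1, u == (2 ^ a).-1].
have [s lt_s Hs] := bit_comprehension f (2 ^ A).
have s_ones a : a <= A -> bit s (2 ^ a).-1.
  move=> le_a; rewrite Hs; apply/andP; split.
    have : 2 ^ a <= 2 ^ A by rewrite leq_pexp2l.
    have : 0 < 2 ^ a by rewrite expn_gt0.
    lia.
  by apply/existsP; exists (Ordinal (le_a : a < A.+1)).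
have s_inv u : bit s u -> exists2 a, a <= A & u = (2 ^ a).-1.
  by rewrite Hs => /andP[_ /existsP[[a lt_a] /= /eqP->]]; exists a.
have le_sn : s <= n by lia.
have le_bit u : bit s u -> u <= n by move/bit_index_lt; lia.
exists s; split=> //; split; last first.
  exists (2 ^ i.+1).-1; split; first by apply: le_bit; apply: s_ones; lia.
  split; first by apply: s_ones; lia.
  rewrite !bit_ones; split; first by lia.
  split; first by lia.
  exists (2 ^ j.+1).-1; split; first by apply: le_bit; apply: s_ones; lia.
  by split; [apply: s_ones | rewrite bit_ones].
move=> u le_u w le_w j' le_j i' le_i su sw.
have [[a le_a ->] [c le_c ->]] := (s_inv u su, s_inv w sw).
rewrite !bit_ones => lt_ja /negP le_ai lt_ic.
have lt_ji : j' < i' by lia.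
have [k [ik jk Hk]] := ltn_top_bit lt_ji.
have lt_ki := bit_index_lt ik.
exists k; split; first by lia.
split=> //; split; first exact/negP.
split.
  exists (2 ^ A).-1; split; first by apply: le_bit; apply: s_ones.
  by split; [apply: s_ones | rewrite bit_ones; lia].
move=> m le_m /bit_neqP ne_m ne_mk.
have lt_mk : m < k.
  case: (ltngtP m k) => // /Hk E; by rewrite E eqxx in ne_m.
have s_m : bit s (2 ^ m.+1).-1 by apply: s_ones; lia.
(* The segment [{0, ..., m}] separates [m] from the larger position [k]. *)
exists (2 ^ m.+1).-1; split; first exact: le_bit.
by rewrite !bit_ones; split=> //; split; lia.
Qed.

Lemma bitwise_lt_ltn (R : nat -> nat -> nat -> Prop) n x y :
  (forall m k, m <= n -> k <= n -> R n m k -> m < k) ->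
  x <= n -> y <= n -> bitwise_lt R n x y -> x < y.
Proof.
move=> HR le_x le_y [k [le_k [yk [xk H]]]].
apply: (top_bit_ltn yk); first exact/negP.
move=> j ne_j; have [-> //|/eqP ne_jk] := eqVneq j k.
(* The quantifier bounded by [n] sees every difference, because a position holding a digit is
   smaller than the number. *)
suff le_j : j <= n by apply: ltnW; apply: HR => //; apply: H => //; apply/bit_neqP.
case xj: (bit x j); first by have := bit_index_lt xj; lia.
by case yj: (bit y j) ne_j; rewrite xj // => _; have := bit_index_lt yj; lia.
Qed.

(** [R] has to be complete only below digit positions [k] of [y]; since [2 ^ k <= y], this gains one
    exponential per round. *)
Lemma ltn_bitwise_lt (R : nat -> nat -> nat -> Prop) n x y : y <= n -> x < y ->
  (forall m k, m < k -> bit y k -> R n m k) -> bitwise_lt R n x y.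
Proof.
move=> le_y lt_xy HR; have [k [yk xk Hk]] := ltn_top_bit lt_xy.
have lt_ky := bit_index_lt yk.
exists k; split; first by lia.
split=> //; split; first exact/negP.
move=> m _ /bit_neqP ne_m ne_mk; apply: HR => //.
by case: (ltngtP m k) => // /Hk E; rewrite E eqxx in ne_m.
Qed.

Lemma double_le_exp2 a : 2 * a <= 2 ^ a.
Proof. by elim: a => // -[|a] // IHa; rewrite expnS; lia. Qed.

(** Soundness passes through each round. For completeness, the positions satisfy [2 ^ y1 <= y],
    [2 ^ y2 <= y1] and [2 ^ y3 <= y2]. Hence [2 ^ y3.+1 <= 2 * y2 <= 2 ^ y2 <= y1], which gives the
    bound needed for a segment code. *)
Lemma bitwise_lt3P n x y : x <= n -> y <= n ->
  (bitwise_lt (bitwise_lt (bitwise_lt seg_lt)) n x y <-> x < y).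
Proof.
move=> le_x le_y; split.
  apply: bitwise_lt_ltn le_x le_y => x1 y1; apply: bitwise_lt_ltn => x2 y2.
  by apply: bitwise_lt_ltn => x3 y3 _ _; apply: seg_lt_ltn.
move=> lt_xy; apply: ltn_bitwise_lt => // x1 y1 lt1 b1.
have lt_y1 := bit_index_lt b1.
apply: ltn_bitwise_lt => // [|x2 y2 lt2 b2]; first by lia.
have lt_y2 := bit_index_lt b2.
apply: ltn_bitwise_lt => // [|x3 y3 lt3 b3]; first by lia.
apply: ltn_seg_lt => //.
apply: leq_trans le_y; apply: leq_trans (bit_ge b1).
rewrite leq_pexp2l //; apply: leq_trans (bit_ge b2).
by apply: leq_trans (double_le_exp2 y2); rewrite expnS leq_mul2l bit_ge.
Qed.

Lemma definable_ltn_Bit sg x y :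
  definable sg [:: Bit_pred] (fun n e => e x < e y).
Proof.
apply: definable_iff (_ : definable _ _ (fun n e =>
  bitwise_lt (bitwise_lt (bitwise_lt seg_lt)) n (e x) (e y))).
  by move=> n e He; apply: bitwise_lt3P.
have step := @definable_bitwise_lt sg [:: Bit_pred] _ (@definable_bit sg).
exact/step/step/step/definable_seg_lt.
Qed.
#[local] Hint Resolve definable_ltn_Bit : definable.

(** * The second order *)

(** As [i < 2 ^ i], a marked number stores the pair of [i] and [2 ^ i]: the top digit gives the
    power, the rest gives [i]. Taking [i] odd makes the number odd, so even numbers stay
    unmarked. *)
Definition mark (x : nat) : bool := [exists i : 'I_x, odd i && (x == 2 ^ i + i)].

Lemma markP x : reflect (exists2 i, odd i & x = 2 ^ i + i) (mark x).
Proof.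
apply: (iffP existsP) => [[i /andP[oi /eqP Ex]]|[i oi Ex]]; first by exists i.
have lt_ix : i < x by have := expn_gt0 2 i; lia.
by exists (Ordinal lt_ix); rewrite /= oi Ex eqxx.
Qed.

Lemma mark_odd x : mark x -> odd x.
Proof. by case/markP => -[|i] oi -> //; rewrite oddD oddX oi. Qed.

Lemma bit_exp2 k i : bit (2 ^ k) i = (i == k).
Proof.
by rewrite -[2 ^ k]addn0 bit_top_add ?expn_gt0 // bit_zero orbF.
Qed.

(** The lexicographic order of digit sequences read from the lowest digit up; 0 comes first, and
    even numbers precede odd ones. *)
Definition low_lt (x y : nat) : Prop :=
  exists k, [/\ ~~ bit x k, bit y k & forall j, j < k -> bit x j = bit y j].

Definition prec (x y : nat) : Prop :=
  mark x /\ ~~ mark y \/ mark x = mark y /\ low_lt x y.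

Lemma low_lt_irr x : ~ low_lt x x.
Proof. by case=> k [/negPf->]. Qed.

Lemma low_lt_trans y x z : low_lt x y -> low_lt y z -> low_lt x z.
Proof.
move=> [k [xk yk Hk]] [m [ym zm Hm]].
case: (ltngtP k m) => [lt_km|lt_mk|Ekm].
- by exists k; rewrite -Hm //; split=> // j lt_jk; rewrite Hk // Hm // (ltn_trans lt_jk).
- by exists m; rewrite Hk //; split=> // j lt_jm; rewrite Hk ?Hm // (ltn_trans lt_jm).
- by rewrite Ekm (negPf ym) in yk.
Qed.

Lemma low_lt_total x y : x <> y -> low_lt x y \/ low_lt y x.
Proof.
move/neq_low_bit=> [k ne_k Hk]; case xk: (bit x k) ne_k; case yk: (bit y k) => // _.
  by right; exists k; rewrite xk yk; split=> // j /Hk.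
by left; exists k; rewrite xk yk.
Qed.

Lemma prec_strict_linear_order : strict_linear_order prec.
Proof.
split; first by move=> x [[->]|[_ /low_lt_irr]].
split=> [x y z|x y /low_lt_total]; rewrite /prec.
  case: (mark x) (mark y) (mark z) => -[] [] [[// _ _]|[// _ xy]] [[//]|[// _ yz]];
    by [left | right; split=> //; apply: low_lt_trans yz].
by case: (mark x) (mark y) => -[] H; [case: H; tauto|left;left|right;left|case: H; tauto].
Qed.

Lemma prec0 x : prec x 0 <-> mark x.
Proof.
have m0 : mark 0 = false by apply/negbTE/negP => /mark_odd.
rewrite /prec m0; split=> [[[]//|[_ [k []]]]|mx]; last by left.
by rewrite bit_zero.
Qed.

Lemma prec_even x y : ~~ odd x -> ~~ odd y -> (prec x y <-> low_lt x y).
Proof.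
have H z : ~~ odd z -> mark z = false by move=> oz; apply: contraNF oz; apply: mark_odd.
by move=> /H mx /H my; rewrite /prec mx my; split=> [[[]|[]]//|]; right.
Qed.

(* The unmarked odd numbers come after the even ones, and a number that follows
   a marked one is even. *)
Lemma prec_odd x : odd x <-> mark x \/ exists2 w, x = w.+1 & ~~ mark w /\ prec w x.
Proof.
case: x => [|w]; first by split=> // -[/mark_odd|[]].
split=> [|[/mark_odd//|[_ [<-] [mw]]]].
  rewrite /= => ow; have [|mx] := boolP (mark w.+1); [by left | right].
  exists w => //; have mw : ~~ mark w by apply: contra ow; apply: mark_odd.
  split=> //; right; rewrite (negPf mx) (negPf mw); split=> //.
  by exists 0; rewrite !bit0 /= ow.
(* Consecutive numbers differ in parity, so the deciding position [k] is 0, and there [w.+1] has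
   digit 1. *)
case=> [[mw']|[_ [k [wk xk Hk]]]]; first by rewrite mw' in mw.
case: k wk xk Hk => [|k] wk xk Hk; first by rewrite bit0 in xk.
by have := Hk 0 isT; rewrite !bit0 /=; case: odd.
Qed.

Lemma definable_prec sg x y :
  definable sg [:: Bit_pred] (fun n e => prec (e x) (e y)).
Proof.
have dmark z : definable sg [:: Bit_pred] (fun n e => mark (e z)).
  (* The number [o] without digits is 0, so [bit i o] is the parity of [i]. Since [i < 2 ^ i],
     adding [2 ^ i] to [i] just sets digit [i]. *)
  apply: definable_iff (_ : definable _ _ (fun n e => exists i, i <= n /\
    ((exists o, o <= n /\ ((forall j, j <= n -> ~ bit o j) /\ bit i o)) /\
     forall j, j <= n -> (bit (e z) j <-> j = i \/ bit i j)))); last by definability.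
  move=> n e He; have lt_exp i : i < 2 ^ i by apply: ltn_expl.
  split=> [[i [le_i [[o [le_o [Ho io]] H]]]]|/markP[i oi Ez]].
    have Eo : o = 0.
      apply: bit_inj => j; rewrite bit_zero; apply/negbTE/negP => oj.
      by case: (Ho j) => //; have := bit_index_lt oj; lia.
    apply/markP; exists i; first by rewrite -bit0 -Eo.
    apply: bit_inj => j; rewrite bit_top_add //.
    have [le_j|lt_j] := leqP j n.
      apply/idP/orP=> [/(H j le_j)[->|]|[/eqP E|ij]]; [by left | by right | |];
        by apply/(H j le_j); auto.
    have -> : bit (e z) j = false.
      by apply/negbTE/negP => /bit_index_lt; have := He z; lia.
    have -> : bit i j = false by apply/negbTE/negP => /bit_index_lt; lia.
    by rewrite orbF; apply/esym/eqP; lia.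
  have := He z; have := lt_exp i => ? ?; exists i; split; first by lia.
  split.
    by exists 0; split=> //; rewrite bit0 oi; split=> // j _; rewrite bit_zero.
  move=> j _; rewrite Ez bit_top_add //.
  by split=> [/orP[/eqP|]|[->|->]]; rewrite ?eqxx ?orbT; auto.
have dlow : definable sg [:: Bit_pred] (fun n e => low_lt (e x) (e y)).
  apply: definable_iff (_ : definable _ _ (fun n e => exists k, k <= n /\
    (~ bit (e x) k /\ bit (e y) k /\
     forall j, j <= n -> j < k -> (bit (e x) j <-> bit (e y) j)))); last by definability.
  move=> n e He; split=> [[k [le_k [xk [yk H]]]]|[k [xk yk H]]]; exists k.
    split=> //; first exact/negP.
    move=> j lt_jk; apply/idP/idP => Hj; apply/(H j) => //; lia.
  split; first by have := bit_index_lt yk; have := He y; lia.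
  by split; [apply/negP | split=> // j _ /H->].
apply: definable_iff (_ : definable _ _ (fun n e => mark (e x) /\ ~ mark (e y) \/
  (mark (e x) <-> mark (e y)) /\ low_lt (e x) (e y))).
  move=> n e _; rewrite /prec; case: (mark (e x)) (mark (e y)) => -[] /=; intuition.
by definability.
Qed.

(** * [Bit] is definable from the two orders *)

Section FromOrders.
Context {sg : signature}.
Local Notation L := [:: lt_pred; binpred prec].
Local Notation def := (definable sg L).

Lemma definable_ltn x y : def (fun n e => e x < e y).
Proof. exact: (@definable_binpred sg L ord0 _ erefl). Qed.
#[local] Hint Resolve definable_ltn : definable.

Lemma definable_prec_orders x y : def (fun n e => prec (e x) (e y)).
Proof. exact: (@definable_binpred sg L (@Ordinal 2 1 isT) _ erefl). Qed.
#[local] Hint Resolve definable_prec_orders : definable.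

Lemma definable_zero x : def (fun n e => e x = 0).
Proof.
apply: definable_iff (_ : def (fun n e => forall w, w <= n -> ~ w < e x)); last by definability.
move=> n e He; split=> [H|-> //]; case Ex: (e x) => [//|k].
by case: (H 0); rewrite ?Ex.
Qed.
#[local] Hint Resolve definable_zero : definable.

Lemma definable_succ x y : def (fun n e => e y = (e x).+1).
Proof.
apply: definable_iff (_ : def (fun n e => e x < e y /\
  forall w, w <= n -> e x < w -> ~ w < e y)); last by definability.
move=> n e He; split=> [[lt_xy H]|->]; last by split=> // w _; lia.
have := He y; case: (ltngtP (e y) (e x).+1) => // [|lt_xy' le_y]; first by lia.
by case: (H (e x).+1) => //; lia.
Qed.
#[local] Hint Resolve definable_succ : definable.

Lemma definable_mark x : def (fun n e => mark (e x)).
Proof.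
apply: definable_iff (_ : def (fun n e => exists z, z <= n /\ (z = 0 /\ prec (e x) z))).
  move=> n e _; apply: iff_trans (prec0 (e x)).
  by split=> [[z [_ [-> ]]]|H] //; exists 0.
by definability.
Qed.
#[local] Hint Resolve definable_mark : definable.

Lemma definable_odd x : def (fun n e => odd (e x)).
Proof.
apply: definable_iff (_ : def (fun n e => mark (e x) \/
  exists w, w <= n /\ (e x = w.+1 /\ ~ mark w /\ prec w (e x)))); last by definability.
move=> n e He; apply: iff_trans (iff_sym (prec_odd _)).
split=> [[|[w [_ [Ex [/negP mw pw]]]]]|[|[w Ex [mw pw]]]]; try by left.
  by right; exists w.
right; exists w; split; first by have := He x; lia.
by split=> //; split=> //; apply/negP.
Qed.
#[local] Hint Resolve definable_odd : definable.

(** On even numbers the marks do not interfere, so [prec] agrees with [low_lt] there. *)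
Definition even_low_lt (x y : nat) : Prop := ~ odd x /\ ~ odd y /\ low_lt x y.

Lemma definable_even_low_lt x y : def (fun n e => even_low_lt (e x) (e y)).
Proof.
apply: definable_iff (_ : def (fun n e => ~ odd (e x) /\ ~ odd (e y) /\ prec (e x) (e y))).
  move=> n e _; rewrite /even_low_lt.
  by split=> -[ox [oy H]]; split=> //; split=> //; apply/prec_even => //; apply/negP.
by definability.
Qed.
#[local] Hint Resolve definable_even_low_lt : definable.

(** * Powers of two, and digits indexed by powers of two *)

Definition pow2 (p : nat) : Prop := exists i, p = 2 ^ i.

(** A nonzero number below [2 ^ i] has its lowest digit below [i], hence comes later in [low_lt].
    Conversely, with [a] the lowest digit position of [p], the number [2 ^ a] is at most [p] and
    cannot come after it. *)
Lemma even_pow2P p : ~ odd p -> p <> 0 ->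
  (pow2 p <-> forall z, z < p -> ~ odd z -> z <> 0 -> low_lt p z).
Proof.
move=> op /neq_low_bit[a pa Ha]; rewrite bit_zero eqbF_neg negbK in pa.
split=> [[i Ep] z lt_zp oz /neq_low_bit[k zk Hk]|H].
  rewrite bit_zero eqbF_neg negbK in zk.
  have ne_k j : j <= k -> (j == i) = false.
    move=> le_jk; apply/negbTE/eqP => E; have := bit_ge zk.
    have : 2 ^ i <= 2 ^ k by rewrite leq_pexp2l // -E.
    lia.
  exists k; rewrite zk Ep bit_exp2 ne_k //; split=> // j lt_jk.
  by rewrite Hk // bit_zero bit_exp2 ne_k // ltnW.
exists a; have := bit_ge pa; rewrite leq_eqVlt => /predU1P[-> //|/H []].
- case: a pa {Ha} => [|a]; first by rewrite bit0.
  by rewrite oddX.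
- by have := expn_gt0 2 a; lia.
by move=> k [pk]; rewrite bit_exp2 => /eqP Ek; rewrite Ek pa in pk.
Qed.

Lemma definable_pow2 x : def (fun n e => pow2 (e x)).
Proof.
apply: definable_iff (_ : def (fun n e => (exists z, z <= n /\ (z = 0 /\ e x = z.+1)) \/
  (~ odd (e x) /\ ~ e x = 0 /\ forall z, z <= n ->
    z < e x -> ~ odd z -> ~ z = 0 -> even_low_lt (e x) z))); last by definability.
move=> n e He; split=> [[[z [_ [-> ->]]]|[ox [nz H]]]|]; first by exists 0.
  apply/even_pow2P => // z lt_z oz z0.
  by have [_ [_]] : even_low_lt (e x) z by apply: H => //; have := He x; lia.
case=> -[|i] Ex; first by left; exists 0; rewrite Ex.
have ox : ~ odd (e x) by rewrite Ex oddX.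
have nz : e x <> 0 by have := expn_gt0 2 i.+1; lia.
right; split=> //; split=> // z _ lt_z oz z0; split=> //; split=> //.
by move: z lt_z oz z0; apply/even_pow2P => //; exists i.+1.
Qed.
#[local] Hint Resolve definable_pow2 : definable.

(** For a power of two [p] this expresses [z < 2 * p] even when [2 * p] lies outside the universe,
    where the condition becomes vacuous. *)
Definition below_double (n p z : nat) : Prop :=
  forall q, q <= n -> pow2 q -> p < q -> z < q.

Lemma definable_below_double x y : def (fun n e => below_double n (e x) (e y)).
Proof. by rewrite /below_double; definability. Qed.
#[local] Hint Resolve definable_below_double : definable.

Lemma below_doubleP n i z : z <= n -> (below_double n (2 ^ i) z <-> z < 2 ^ i.+1).
Proof.
move=> le_z; split=> [H|lt_z q _ [j ->]].
  have [le_n|] := leqP (2 ^ i.+1) n; last by lia.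
  by apply: H => //; [exists i.+1 | rewrite ltn_exp2l].
by rewrite ltn_exp2l // => lt_ij; apply: leq_trans lt_z _; rewrite leq_exp2l.
Qed.

(* Among the even numbers below [2 ^ i.+1], the last one not after [x] in the
   low-bit-first order is [x %% 2 ^ i.+1]; its bit [i] is set iff it is at
   least [2 ^ i]. *)
Lemma even_bitP n x i : x <= n -> ~ odd x ->
  (bit x i <-> exists z, z <= n /\ (~ odd z /\ ~ z < 2 ^ i /\ below_double n (2 ^ i) z /\
     (z = x \/ even_low_lt z x) /\
     forall w, w <= n -> ~ odd w -> below_double n (2 ^ i) w -> even_low_lt z w ->
       ~ (w = x \/ even_low_lt w x))).
Proof.
move=> le_x ox; pose y := x %% 2 ^ i.+1.
have lt_y : y < 2 ^ i.+1 by rewrite ltn_mod expn_gt0.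
have le_y : y <= n by apply: leq_trans (leq_mod _ _) le_x.
have By j : bit y j = (j < i.+1) && bit x j by apply: bit_mod.
have oy : ~ odd y by rewrite -bit0 By bit0.
have yx : y = x \/ even_low_lt y x.
  have [|ne_yx] := eqVneq y x; [by left | right; split=> //; split=> //].
  have [k ne_k Hk] := neq_low_bit (elimN eqP ne_yx); exists k.
  by move: ne_k; rewrite By; case: (k < _); case: (bit x k).
(* If [w] and [x] first differ at a position up to [i], then [w] and [y] differ in the same way;
   otherwise [w] has exactly the digits of [y]. *)
have max w : w < 2 ^ i.+1 -> w = x \/ low_lt w x -> w = y \/ low_lt w y.
  move=> lt_w; have Bw j : i.+1 <= j -> bit w j = false.
    move=> le_j; apply/negbTE/negP => /bit_ge; have : 2 ^ i.+1 <= 2 ^ j by rewrite leq_exp2l.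
    lia.
  case=> [Ew|[k [wk xk Hk]]]; first by left; rewrite /y -Ew modn_small.
  have [lt_k|le_k] := ltnP k i.+1.
    right; exists k; split=> //; first by rewrite By lt_k.
    by move=> j lt_j; rewrite By (ltn_trans lt_j) // Hk.
  left; apply: bit_inj => j; rewrite By; have [lt_j|le_j] := ltnP j i.+1.
    by rewrite Hk // (leq_trans lt_j).
  exact: Bw.
split=> [xi|[z [le_z [oz [le_iz [/(below_doubleP _ le_z) lt_z [zx Hz]]]]]]].
  exists y; split=> //; split=> //; split.
    have : 2 ^ i <= y by apply: bit_ge; rewrite By ltnSn xi.
    lia.
  split; first exact/below_doubleP.
  split=> // w le_w ow /(below_doubleP _ le_w) lt_w [_ [_ yw]] wx.
  have [|Ew|wy] := max w lt_w.
  - by case: wx => [->|[_ []]]; auto.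
  - by rewrite Ew in yw; apply: low_lt_irr yw.
  - exact: low_lt_irr (low_lt_trans yw wy).
have Ezy : z = y.
  have [|//|zy] := max z lt_z; first by case: zx => [->|[_ []]]; auto.
  by case: (Hz y) => //; apply/below_doubleP.
have : bit y i; last by rewrite By => /andP[].
have y_ge : 2 ^ i <= y by lia.
rewrite -(subnKC y_ge) bit_top_add ?eqxx //.
by rewrite expnS in lt_y; lia.
Qed.

(** The position is named by its power [p], as the map from [i] to [2 ^ i] is not yet known to be
    definable. *)
Definition bit_at (x p : nat) : Prop := exists2 i, p = 2 ^ i & bit x i.

(** The digit at [2 ^ 0] is the parity. For higher digits an odd number is replaced by its even
    predecessor [t], to which [even_bitP] applies. *)
Lemma definable_bit_at x y : def (fun n e => bit_at (e x) (e y)).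
Proof.
apply: definable_iff (_ : def (fun n e => pow2 (e y) /\ (
  (exists z, z <= n /\ (z = 0 /\ e y = z.+1)) /\ odd (e x) \/
  ~ (exists z, z <= n /\ (z = 0 /\ e y = z.+1)) /\
  exists t, t <= n /\ (~ odd t /\ (e x = t \/ e x = t.+1) /\
    exists z, z <= n /\ (~ odd z /\ ~ z < e y /\ below_double n (e y) z /\
     (z = t \/ even_low_lt z t) /\
     forall w, w <= n -> ~ odd w -> below_double n (e y) w -> even_low_lt z w ->
       ~ (w = t \/ even_low_lt w t)))))); last by definability.
move=> n e He.
have one : (exists z, z <= n /\ (z = 0 /\ e y = z.+1)) <-> e y = 1.
  by split=> [[z [_ [-> ->]]] //|Ey]; exists 0.
have bitSS t i : ~ odd t -> bit t.+1 i.+1 = bit t i.+1.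
  by move=> ot; rewrite !bitS; congr bit; lia.
split.
  case=> -[i Ey] [[/one Ey1 ox]|[/one Ey1 [t [le_t [ot [Ex H]]]]]].
    by exists 0; rewrite ?bit0.
  exists i => //; case: i Ey => [|i] Ey; first by rewrite Ey in Ey1.
  rewrite Ey in H; move/even_bitP: H => /(_ le_t ot).
  by case: Ex => -> //; rewrite bitSS.
case=> i Ey xi; split; first by exists i.
case: i Ey xi => [|i] Ey xi.
  by left; rewrite -bit0; split=> //; apply/one.
right; split; first by rewrite one Ey; have := expn_gt0 2 i; rewrite expnS; lia.
have [t [Ex ot]] : exists t, (e x = t \/ e x = t.+1) /\ ~ odd t.
  have [ox|ox] := boolP (odd (e x)); last by exists (e x); split; [left | apply/negP].
  by exists (e x).-1; split; [right|]; case: (e x) ox => //= k /negP.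
have le_t : t <= n by have := He x; lia.
exists t; split=> //; split=> //; split=> //.
rewrite Ey; apply/even_bitP => //.
by case: Ex => Ex; rewrite Ex ?bitSS in xi.
Qed.
#[local] Hint Resolve definable_bit_at : definable.

(** * The map from exponents to powers of two *)

Lemma definable_double x y : def (fun n e => pow2 (e x) /\ e y = 2 * e x).
Proof.
apply: definable_iff (_ : def (fun n e => pow2 (e x) /\ pow2 (e y) /\ e x < e y /\
  forall r, r <= n -> pow2 r -> e x < r -> ~ r < e y)); last by definability.
move=> n e He; split=> [[[i Ex] [[j Ey] [lt_xy H]]]|[[i Ex] Ey]].
  split; first by exists i.
  rewrite Ex Ey ltn_exp2l // in lt_xy; rewrite Ex Ey -expnS; congr (2 ^ _).
  case: (ltngtP i.+1 j) => [lt_ij||//]; last by lia.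
  case: (H (2 ^ i.+1)); rewrite ?Ex ?Ey ?ltn_exp2l //; last by exists i.+1.
  by have := He y; rewrite Ey; apply: leq_trans; rewrite leq_exp2l // ltnW.
split; first by exists i.
rewrite Ey Ex -expnS; split; first by exists i.+1.
split; first by rewrite ltn_exp2l.
by move=> r _ [j ->]; rewrite !ltn_exp2l //; lia.
Qed.

(** For a power [e y] above [e x], the number whose digits are those of [e x] and the one of [e y]
    is their sum; it is marked exactly when [e x] is odd and [e y = 2 ^ e x]. The size bound keeps
    this sum in the universe. *)
Lemma definable_marked_exp x y :
  def (fun n e => odd (e x) /\ e y = 2 ^ e x /\ 2 ^ e x + e x <= n).
Proof.
apply: definable_iff (_ : def (fun n e => pow2 (e y) /\ e x < e y /\
  exists z, z <= n /\ (mark z /\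
    forall r, r <= n -> (bit_at z r <-> r = e y \/ bit_at (e x) r)))); last by definability.
move=> n e He.
have inj i j : 2 ^ i = 2 ^ j -> i = j by move=> /eqP; rewrite eqn_exp2l // => /eqP.
split=> [[[i Ey] [lt_xy [z [le_z [/markP[k ok Ez] H]]]]]|[ox [Ey le_n]]].
  have lt_k : k < 2 ^ k by apply: ltn_expl.
  have Ez' : z = 2 ^ i + e x.
    apply: bit_inj => j; rewrite bit_top_add -?Ey //.
    have at_j u : bit_at u (2 ^ j) <-> bit u j.
      by split=> [[j' /inj->]|]; last exists j.
    have [le_j|lt_j] := leqP (2 ^ j) n.
      have := H _ le_j; rewrite !at_j Ey => -[H1 H2].
      apply/idP/orP => [/H1[/inj->|]|Hj]; rewrite ?eqxx; auto.
      by apply: H2; case: Hj => [/eqP->|]; auto.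
    have out u : u <= n -> bit u j = false.
      by move=> le_u; apply/negbTE/negP => /bit_ge; lia.
    rewrite !out //; have [Eji|//] := eqVneq j i.
    by have := He y; rewrite Ey -Eji; lia.
  (* Both [2 ^ i + e x] and [2 ^ k + k] have a remainder smaller than the power, so equal sums have
     equal top powers. *)
  have Eik : i = k.
    apply/eqP; rewrite Ey in lt_xy; rewrite Ez in Ez'.
    have lt_exp a b : a < b -> 2 * 2 ^ a <= 2 ^ b by move=> lt_ab; rewrite -expnS leq_exp2l.
    by case: ltngtP => // /lt_exp; lia.
  have Exk : e x = k by rewrite Ez Eik in Ez'; lia.
  by rewrite Exk Ey Eik -Ez.
have lt_x : e x < 2 ^ e x by apply: ltn_expl.
have bitz j : bit (2 ^ e x + e x) j = (j == e x) || bit (e x) j by apply: bit_top_add.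
split; first by exists (e x).
rewrite Ey; split; first exact: lt_x.
exists (2 ^ e x + e x); split; first exact: le_n.
split; first by apply/markP; exists (e x).
move=> r _; split=> [[j ->]|[->|[j -> xj]]].
- rewrite bitz => /orP[/eqP->|xj]; first by left.
  by right; exists j.
- by exists (e x); rewrite // bitz eqxx.
- by exists j; rewrite // bitz xj orbT.
Qed.
#[local] Hint Resolve definable_double definable_marked_exp : definable.

(** For an exponent of at least 2, the odd one among its two predecessors is used as [i], and the
    power is doubled once or twice. Then [2 ^ i + i <= 2 ^ i.+1 <= 2 ^ e x], so the marked number
    fits into the universe; exponents 0 and 1 are treated separately. *)
Lemma definable_exp x y : def (fun n e => e y = 2 ^ e x).
Proof.
apply: definable_iff (_ : def (fun n e =>
  (e x = 0 /\ e y = (e x).+1) \/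
  (exists z, z <= n /\ (z = 0 /\ e x = z.+1 /\ e y = (e x).+1)) \/
  exists i, i <= n /\ exists q, q <= n /\
    ((odd i /\ q = 2 ^ i /\ 2 ^ i + i <= n) /\
     (e x = i.+1 /\ (pow2 q /\ e y = 2 * q) \/
      exists j, j <= n /\ exists r, r <= n /\
        (j = i.+1 /\ e x = j.+1 /\ (pow2 q /\ r = 2 * q) /\ (pow2 r /\ e y = 2 * r))))));
  last by definability.
move=> n e He; split.
  case=> [[-> ->]|[[z [_ [-> [-> ->]]]]|[i [_ [q [_ [[_ [-> _]] H]]]]]]] //.
  by case: H => [[-> [_ ->]]|[j [_ [r [_ [-> [-> [[_ ->] [_ ->]]]]]]]]]; rewrite !expnS.
case Ex: (e x) => [|[|k]] Ey; first by left.
  by right; left; exists 0.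
right; right; have le_y := He y; have le_x := He x.
rewrite Ey !expnS in le_y; have lt_k : k < 2 ^ k by apply: ltn_expl.
have [ok|ok] := boolP (odd k).
  exists k; split; first by lia.
  exists (2 ^ k); split; first by lia.
  split; first by split=> //; split=> //; lia.
  right; exists k.+1; split; first by lia.
  exists (2 ^ k.+1); rewrite expnS; split; first by lia.
  split=> //; split=> //; split; first by split=> //; exists k.
  by rewrite Ey -expnS; split; [exists k.+1 | rewrite expnS].
exists k.+1; split; first by lia.
exists (2 ^ k.+1); rewrite expnS; split; first by lia.
split; first by split=> //; split=> //; lia.
left; split=> //; rewrite Ey -expnS; split; [by exists k.+1 | by rewrite expnS].
Qed.
#[local] Hint Resolve definable_exp : definable.

Lemma definable_bit_orders x y : def (fun n e => bit (e x) (e y)).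
Proof.
apply: definable_iff (_ : def (fun n e => exists p, p <= n /\
  (p = 2 ^ e y /\ bit_at (e x) p))); last by definability.
move=> n e He; split=> [[p [_ [-> [i /eqP]]]]|xy].
  by rewrite eqn_exp2l // => /eqP->.
exists (2 ^ e y); split; first by have := bit_ge xy; have := He x; lia.
by split=> //; exists (e y).
Qed.

End FromOrders.

Theorem theorem5p2 :
  exists prec : nat -> nat -> Prop,
    strict_linear_order prec /\
    same_expressive_power [:: lt_pred; binpred prec] [:: Bit_pred].
Proof.
exists prec; split; first exact: prec_strict_linear_order.
move=> sg; split.
  apply: translate => -[[|[|//]] lt_j] /=.
    by exists (fun a b => a < b) => // x y; apply: definable_ltn_Bit.
  by exists prec => // x y; apply: definable_prec.
have H : forall g : formula sg [:: Bit_pred],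
    exists f : formula sg [:: lt_pred; binpred prec], equivalent g f.
  apply: translate => -[[|//] lt_j] /=.
  exists (fun a i => ~ (2 %| a %/ 2 ^ i)) => // x y.
  by apply: definable_iff (definable_bit_orders x y) => n e _; apply: bit_Bit_pred.
move=> g; have [f Hf] := H g; exists f => n S a Ha.
exact: iff_sym (Hf n S a Ha).
Qed.
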